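(* Let $L$ be a nilpotent, finite-dimensional diassociative algebra over a field $\mathbb{F}$, and let $n=\dim L$ and $d=\dim(L/L')$. Then $$\dim\mathcal{H}^2(L,\mathbb{F})\le -2d^2+d+4nd-n.$$
   Context: A diassociative algebra $L$ over a field $\mathbb{F}$ is an $\mathbb{F}$-vector space with two associative bilinear products $\dashv,\vdash$ satisfying $x\dashv(y\dashv z)=x\dashv(y\vdash z)$, $(x\vdash y)\dashv z=x\vdash(y\dashv z)$, $(x\dashv y)\vdash z=(x\vdash y)\vdash z$ for all $x,y,z\in L$. For subalgebras $X,Y$ of $L$, $X\lozenge Y=X\dashv Y+X\vdash Y$, where $X\dashv Y$ and $X\vdash Y$ are the spans of the corresponding products. $L'=L\lozenge L$. The lower central series is $L^1=L$, $L^{k+1}=L^1\lozenge L^k+L^2\lozenge L^{k-1}+\cdots+L^k\lozenge L^1$; $L$ is nilpotent if $L^k=0$ for some $k$. For a diassociative algebra $Q$ over $\mathbb{F}$, $\mathcal{Z}^2(Q,\mathbb{F})$ is the space of pairs $(f_{\dashv},f_{\vdash})$ of bilinear forms $Q\times Q\to\mathbb{F}$ such that for all $i,j,k\in Q$: $f_{\dashv}(i,j\dashv k)=f_{\dashv}(i,j\vdash k)$; $f_{\dashv}(i\vdash j,k)=f_{\vdash}(i,j\dashv k)$; $f_{\vdash}(i\dashv j,k)=f_{\vdash}(i\vdash j,k)$; $f_{\dashv}(i,j\dashv k)=f_{\dashv}(i\dashv j,k)$; $f_{\vdash}(i,j\vdash k)=f_{\vdash}(i\vdash j,k)$. $\mathcal{B}^2(Q,\mathbb{F})$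 is the subspace of pairs for which there is a linear map $\varepsilon:Q\to\mathbb{F}$ with $f_{\dashv}(x,y)=-\varepsilon(x\dashv y)$ and $f_{\vdash}(x,y)=-\varepsilon(x\vdash y)$ for all $x,y$; and $\mathcal{H}^2(Q,\mathbb{F})=\mathcal{Z}^2(Q,\mathbb{F})/\mathcal{B}^2(Q,\mathbb{F})$. *)

(* Defs.v *)
From HB Require Import structures.
From mathcomp Require Import all_boot all_order all_algebra.
From mathcomp Require Import ring.

Set Implicit Arguments.
Unset Strict Implicit.
Unset Printing Implicit Defensive.

Import GRing.Theory.
Local Open Scope ring_scope.
Local Open Scope quotient_scope.

Reserved Notation "x ⊣ y" (at level 40, left associativity).
Reserved Notation "x ⊢ y" (at level 40, left associativity).
Reserved Notation "U ◊ V" (at level 40, left associativity).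

(* Quotient spaces: mathcomp has the quotient of a zmodType by a subgroup      *)
(* (ring_quotient); the scaling and the finite dimension are added here.       *)

Definition vquot (F : fieldType) (V : vectType F) (U : {vspace V}) : Type :=
  Quotient.quot U.

Section VQuot.
Variables (F : fieldType) (V : vectType F) (U : {vspace V}).
Local Notation Q := (vquot U).

HB.instance Definition _ := GRing.Zmodule.on Q.

Definition vpi (v : V) : Q := \pi_(Quotient.quot U) v.
Definition vrepr (q : Q) : V := repr (q : Quotient.quot U).

Lemma vreprK : cancel vrepr vpi.
Proof. exact: reprK. Qed.

Lemma vpi_eq (v w : V) : (vpi v == vpi w) = (v - w \in U).
Proof. by rewrite Quotient.idealrBE. Qed.

Lemma vreprB (v : V) : vrepr (vpi v) - v \in U.
Proof. by rewrite -vpi_eq vreprK. Qed.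

Fact vpi_is_zmod_morphism : zmod_morphism vpi.
Proof. by move=> v w; rewrite /vpi raddfB. Qed.
HB.instance Definition _ := GRing.isZmodMorphism.Build V Q vpi
  vpi_is_zmod_morphism.

Definition vquot_scale (a : F) (q : Q) : Q := vpi (a *: vrepr q).

Fact vpi_scale a v : vquot_scale a (vpi v) = vpi (a *: v).
Proof. by apply/eqP; rewrite vpi_eq -scalerBr memvZ // vreprB. Qed.

Fact vquot_scalerA a b q :
  vquot_scale a (vquot_scale b q) = vquot_scale (a * b) q.
Proof. by rewrite -[q]vreprK !vpi_scale scalerA. Qed.

Fact vquot_scale1r : left_id 1 vquot_scale.
Proof. by move=> q; rewrite -[q]vreprK vpi_scale scale1r. Qed.

Fact vquot_scalerDr : right_distributive vquot_scale +%R.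
Proof.
move=> a p q; rewrite -[p]vreprK -[q]vreprK -raddfD !vpi_scale.
by rewrite -raddfD scalerDr.
Qed.

Fact vquot_scalerDl q : {morph vquot_scale^~ q : a b / a + b}.
Proof. by move=> a b; rewrite -[q]vreprK !vpi_scale scalerDl raddfD. Qed.

HB.instance Definition _ := GRing.Zmodule_isLmodule.Build F Q
  vquot_scalerA vquot_scale1r vquot_scalerDr vquot_scalerDl.

Fact vpi_is_scalable : scalable vpi.
Proof. by move=> a v; rewrite -vpi_scale. Qed.
HB.instance Definition _ := GRing.isScalable.Build F V Q _ vpi vpi_is_scalable.

Fact vquot_vect_iso : Vector.axiom (\dim (U^C)) Q.
Proof.
pose W := (U^C)%VS; have [g g_lin g_bij] := subvs_vect_iso W.
have WU0 : (W :&: U = 0)%VS by rewrite capvC capv_compl.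
have WUf v : v \in (W + U)%VS by rewrite addvC addv_complf memvf.
pose p (v : V) : subvs_of W := vsproj W (daddv_pi W U v).
have p_lin : linear p by move=> a u v; rewrite /p !linearP.
pose lp : {linear V -> subvs_of W} :=
  HB.pack p (GRing.isLinear.Build _ _ _ _ p p_lin).
have p0 u : u \in U -> lp u = 0.
  move=> Uu; rewrite /= /p; suff -> : daddv_pi W U u = 0 by rewrite linear0.
  have := daddv_pi_add WU0 (WUf u).
  by rewrite (daddv_pi_id (capv_compl U) Uu) => /(canRL (addrK _)); rewrite subrr.
have pE q v : q = vpi v -> lp (vrepr q) = lp v.
  by move=> ->; apply/eqP; rewrite -subr_eq0 -linearB p0 // vreprB.
pose lg : {linear subvs_of W -> 'rV_(\dim W)} :=
  HB.pack g (GRing.isLinear.Build _ _ _ _ g g_lin).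
exists (fun q => lg (lp (vrepr q))).
  move=> a q r; rewrite -!linearP; congr (lg _); apply: pE.
  by rewrite linearP /= !vreprK.
case: g_bij => g' gK g'K; exists (fun x => vpi (vsval (g' x))) => [q|x] /=.
  rewrite gK -[RHS]vreprK; apply/eqP; rewrite vpi_eq /p vsprojK ?memv_pi //.
  rewrite -{2}(daddv_pi_add WU0 (WUf (vrepr q))) opprD addrA subrr add0r.
  by rewrite memvN memv_pi.
rewrite -[RHS]g'K; congr g; apply: etrans (pE _ (vsval (g' x)) erefl) _.
rewrite /= /p.
by rewrite daddv_pi_id ?vsvalK ?subvsP.
Qed.

HB.instance Definition _ := Lmodule_hasFinDim.Build F Q vquot_vect_iso.

Lemma dim_vquot : \dim {: Q} = (\dim {: V} - \dim U)%N.
Proof. by rewrite dimvf -dimv_compl. Qed.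

End VQuot.

HB.mixin Record Lmodule_isDiass (F : fieldType) L of GRing.Lmodule F L := {
  dleft : L -> L -> L;
  dright : L -> L -> L;
  dleft_bilinear : bilinear_for *:%R *:%R dleft;
  dright_bilinear : bilinear_for *:%R *:%R dright;
  dleftA : associative dleft;
  drightA : associative dright;
  dleft_lr : forall x y z, dleft x (dleft y z) = dleft x (dright y z);
  dright_left : forall x y z, dleft (dright x y) z = dright x (dleft y z);
  dright_lr : forall x y z, dright (dleft x y) z = dright (dright x y) z
}.

#[short(type="diassType")]
HB.structure Definition Diass (F : fieldType) :=
  { L of Lmodule_isDiass F L & GRing.Lmodule F L }.

#[short(type="fdDiassType")]
HB.structure Definition FDDiass (F : fieldType) :=
  { L of Lmodule_isDiass F L & Vector F L }.

Notation "x ⊣ y" := (dleft x y) : ring_scope.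
Notation "x ⊢ y" := (dright x y) : ring_scope.

Section DiassTheory.
Variables (F : fieldType) (L : fdDiassType F).
Implicit Types (x y z : L) (U V W : {vspace L}).

HB.instance Definition _ :=
  bilinear_isBilinear.Build F L L L _ _ (@dleft F L) (@dleft_bilinear F L).
HB.instance Definition _ :=
  bilinear_isBilinear.Build F L L L _ _ (@dright F L) (@dright_bilinear F L).

(* The span of the products of elements of U and V; by bilinearity, bases are  *)
(* enough (see span_prodP).                                                    *)
Definition span_prod (op : L -> L -> L) U V : {vspace L} :=
  <<[seq op u v | u <- vbasis U, v <- vbasis V]>>%VS.

Lemma memv_span_prod (op : {bilinear L -> L -> L}) U V u v :
  u \in U -> v \in V -> op u v \in span_prod op U V.
Proof.
move=> /coord_vbasis-> /coord_vbasis->.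
rewrite linear_sumlz memv_suml // => i _; rewrite linear_sumr memv_suml // => j _.
rewrite linearZl_LR linearZr_LR /= !memvZ // memv_span //.
by apply/allpairsP; exists ((vbasis U)`_i, (vbasis V)`_j); rewrite !memt_nth.
Qed.

Lemma span_prodP (op : {bilinear L -> L -> L}) U V W :
  reflect {in U & V, forall u v, op u v \in W} (span_prod op U V <= W)%VS.
Proof.
apply: (iffP idP) => [sW u v Uu Vv | sW].
  by rewrite (subvP sW) ?memv_span_prod.
apply/span_subvP=> _ /allpairsP[[u v] /= [Uu Vv ->]].
by rewrite sW ?vbasis_mem.
Qed.

Definition dprod U V : {vspace L} :=
  (span_prod (@dleft F L) U V + span_prod (@dright F L) U V)%VS.
Local Notation "U ◊ V" := (dprod U V).

Definition derived : {vspace L} := fullv ◊ fullv.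

(* lcs_upto k is the sequence [:: L^1; ...; L^k]. *)
Fixpoint lcs_upto (k : nat) : seq {vspace L} :=
  if k is k'.+1 then
    let s := lcs_upto k' in
    rcons s (if k' is 0 then fullv
             else \sum_(i < k') nth fullv s i ◊ nth fullv s (k'.-1 - i))%VS
  else [::].

(* L^k, for k >= 1; the value at k = 0 is not used. *)
Definition lcs (k : nat) : {vspace L} := nth fullv (lcs_upto k) k.-1.

Lemma size_lcs_upto k : size (lcs_upto k) = k.
Proof. by elim: k => //= k IHk; rewrite size_rcons IHk. Qed.

Lemma nth_lcs_upto k i : (i < k)%N -> nth fullv (lcs_upto k) i = lcs i.+1.
Proof.
elim: k => // k IHk; rewrite ltnS leq_eqVlt => /predU1P[-> // | lt_ik].
by rewrite /= nth_rcons size_lcs_upto lt_ik IHk.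
Qed.

Lemma lcs1 : lcs 1 = fullv.
Proof. by []. Qed.

Lemma lcsS k : (0 < k)%N ->
  lcs k.+1 = (\sum_(1 <= i < k.+1) lcs i ◊ lcs (k.+1 - i))%VS.
Proof.
case: k => // k _; rewrite {1}/lcs.
rewrite (_ : lcs_upto k.+2 = rcons (lcs_upto k.+1) (\sum_(i < k.+1)
  nth fullv (lcs_upto k.+1) i ◊ nth fullv (lcs_upto k.+1) (k - i))%VS) //.
rewrite nth_rcons size_lcs_upto ltnn eqxx big_add1 /= big_mkord.
apply: eq_bigr => i _; have le_ik : (i <= k)%N by rewrite -ltnS.
rewrite !(nth_lcs_upto (k := k.+1)) ?ltnS ?leq_subr //.
by rewrite subSS subSn.
Qed.

Definition nilpotent_diass : Prop := exists2 k, (0 < k)%N & lcs k = 0%VS.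

(* Bilinear forms on L, curried so as to form a vectType; form_of makes one    *)
(* out of a function L -> L -> F.                                              *)
Definition biform := 'Hom(L, 'Hom(L, F^o)).
Definition cochain2 : vectType F := (biform * biform)%type.

Definition form_of (b : L -> L -> F^o) : biform :=
  linfun (fun x => linfun (b x) : 'Hom(L, F^o)).

Lemma linfun_raw (aT rT : vectType F) (f : aT -> rT) :
  linear f -> linfun f =1 f.
Proof.
move=> f_lin x.
pose fL : {linear aT -> rT} := HB.pack f (GRing.isLinear.Build _ _ _ _ f f_lin).
exact: (lfunE fL).
Qed.

Lemma form_ofE (b : L -> L -> F^o) :
  bilinear_for *:%R *:%R b -> forall x y, form_of b x y = b x y.
Proof.
move=> [bl br] x y; have lE u : linfun (b u) =1 b u by apply: linfun_raw; apply: br.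
rewrite /form_of linfun_raw ?lE // => a u v.
by apply/lfunP=> z; rewrite add_lfunE scale_lfunE !lE bl.
Qed.

Definition cocycle2 (f : cochain2) : Prop :=
  [/\ forall i j k, f.1 i (j ⊣ k) = f.1 i (j ⊢ k),
      forall i j k, f.1 (i ⊢ j) k = f.2 i (j ⊣ k),
      forall i j k, f.2 (i ⊣ j) k = f.2 (i ⊢ j) k,
      forall i j k, f.1 i (j ⊣ k) = f.1 (i ⊣ j) k
    & forall i j k, f.2 i (j ⊢ k) = f.2 (i ⊢ j) k].

(* The five cocycle conditions at (i, j, k), as one linear map in f. *)
Definition cocycle2_defect (i j k : L) (f : cochain2) : 'rV[F]_5 :=
  \row_(t < 5) nth 0 [:: f.1 i (j ⊣ k) - f.1 i (j ⊢ k);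
                         f.1 (i ⊢ j) k - f.2 i (j ⊣ k);
                         f.2 (i ⊣ j) k - f.2 (i ⊢ j) k;
                         f.1 i (j ⊣ k) - f.1 (i ⊣ j) k;
                         f.2 i (j ⊢ k) - f.2 (i ⊢ j) k] t.

(* The space of 2-cocycles: Z2 = {f | cocycle2 f}, by memZ2; it is enough to   *)
(* impose the conditions on a basis of L.                                      *)
Definition Z2 : {vspace cochain2} :=
  (\bigcap_(t : 'I_(\dim {: L}) * 'I_(\dim {: L}) * 'I_(\dim {: L}))
     lker (linfun (cocycle2_defect (vbasis {: L})`_t.1.1
                     (vbasis {: L})`_t.1.2 (vbasis {: L})`_t.2)))%VS.

Definition cobound2 (e : 'Hom(L, F^o)) : cochain2 :=
  (form_of (fun x y => - e (x ⊣ y)), form_of (fun x y => - e (x ⊢ y))).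

(* The space of 2-coboundaries; see memB2. *)
Definition B2 : {vspace cochain2} := limg (linfun cobound2).

(* Z2 / B2: the quotient of Z2, as a space in its own right, by its subspace   *)
(* {z | vsval z \in B2}, which has the dimension of B2 since B2 <= Z2 (B2_sub).*)
Definition H2 : vectType F :=
  vquot (linfun (vsval : subvs_of Z2 -> cochain2) @^-1: B2)%VS.

Fact cocycle2_defect_linear i j k : linear (cocycle2_defect i j k).
Proof.
move=> a [f1 f2] [g1 g2]; apply/rowP=> t; rewrite !mxE /=.
rewrite !(add_lfunE, scale_lfunE).
case: t => [[|[|[|[|[|t]]]]] //= _]; rewrite /GRing.scale /=; ring.
Qed.

Lemma cocycle2_defect0 i j k (f : cochain2) :
  cocycle2_defect i j k f = 0 <->
  [/\ f.1 i (j ⊣ k) = f.1 i (j ⊢ k),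
      f.1 (i ⊢ j) k = f.2 i (j ⊣ k),
      f.2 (i ⊣ j) k = f.2 (i ⊢ j) k,
      f.1 i (j ⊣ k) = f.1 (i ⊣ j) k
    & f.2 i (j ⊢ k) = f.2 (i ⊢ j) k].
Proof.
split=> [/rowP d0 | [e0 e1 e2 e3 e4]].
  have e (t : 'I_5) := d0 t; split; apply/eqP; rewrite -subr_eq0; apply/eqP.
  - by have := e (inord 0); rewrite !mxE inordK.
  - by have := e (inord 1); rewrite !mxE inordK.
  - by have := e (inord 2); rewrite !mxE inordK.
  - by have := e (inord 3); rewrite !mxE inordK.
  - by have := e (inord 4); rewrite !mxE inordK.
apply/rowP; case=> [[|[|[|[|[|t]]]]] //= lt_t5]; rewrite !mxE /=.
- by rewrite e0 subrr.
- by rewrite e1 subrr.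
- by rewrite e2 subrr.
- by rewrite e3 subrr.
- by rewrite e4 subrr.
Qed.

Fact linear_vbasis0 (aT rT : vectType F) (g : aT -> rT) :
  linear g -> (forall p : 'I_(\dim {: aT}), g (vbasis {: aT})`_p = 0) -> forall w, g w = 0.
Proof.
move=> g_lin g0 w; rewrite -(linfun_raw g_lin) (coord_vbasis (memvf w)).
rewrite linear_sum big1 // => p _.
by rewrite linearZ /= linfun_raw // g0 scaler0.
Qed.

Fact cocycle2_defect_trilinear (f : cochain2) :
  [/\ forall j k, linear (fun i => cocycle2_defect i j k f),
      forall i k, linear (fun j => cocycle2_defect i j k f)
    & forall i j, linear (fun k => cocycle2_defect i j k f)].
Proof.
by split=> x y a u v; apply/rowP=> t; rewrite !mxE /=;
  rewrite !(linearPl, linearPr, linearP) ?(add_lfunE, scale_lfunE);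
  case: t => [[|[|[|[|[|t]]]]] //= _]; rewrite /GRing.scale /=; ring.
Qed.

Lemma memZ2 (f : cochain2) : f \in Z2 <-> cocycle2 f.
Proof.
split=> [Zf | f_coc].
  have [lini linj link] := cocycle2_defect_trilinear f.
  have d0 i j k : cocycle2_defect i j k f = 0.
    apply: (linear_vbasis0 (lini j k)) => p.
    apply: (linear_vbasis0 (linj _ k)) => q.
    apply: (linear_vbasis0 (link _ _)) => r.
    have Zsub : (Z2 <= lker (linfun (cocycle2_defect (vbasis {: L})`_p
                     (vbasis {: L})`_q (vbasis {: L})`_r)))%VS.
      by apply: (bigcapv_inf (p, q, r)).
    have := subvP Zsub f Zf.
    rewrite memv_ker linfun_raw /=; last exact: cocycle2_defect_linear.
    by move=> /eqP.
  by split=> i j k; have /cocycle2_defect0[] := d0 i j k.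
rewrite memvE; apply/subv_bigcapP => t _; rewrite -memvE memv_ker.
rewrite linfun_raw; last exact: cocycle2_defect_linear.
by apply/eqP/cocycle2_defect0; case: f_coc.
Qed.

Fact cobound2E (e : 'Hom(L, F^o)) x y :
  ((cobound2 e).1 x y = - e (x ⊣ y)) * ((cobound2 e).2 x y = - e (x ⊢ y)).
Proof.
split; rewrite form_ofE //; split=> z a u v /=.
- by rewrite linearPl linearP opprD scalerN.
- by rewrite linearPr linearP opprD scalerN.
- by rewrite linearPl linearP opprD scalerN.
- by rewrite linearPr linearP opprD scalerN.
Qed.

Lemma cochain2_eq (f g : cochain2) :
  (forall x y, f.1 x y = g.1 x y /\ f.2 x y = g.2 x y) -> f = g.
Proof.
case: f g => [f1 f2] [g1 g2] /= fg; congr (_, _).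
  by apply/lfunP=> x; apply/lfunP=> y; case: (fg x y).
by apply/lfunP=> x; apply/lfunP=> y; case: (fg x y).
Qed.

Fact cobound2_linear : linear cobound2.
Proof.
move=> a e e'; apply: cochain2_eq => x y; rewrite !cobound2E /=.
rewrite !(add_lfunE, scale_lfunE) !cobound2E.
by rewrite !opprD !scalerN.
Qed.

Lemma memB2 (f : cochain2) :
  f \in B2 <-> exists e : 'Hom(L, F^o), forall x y,
    f.1 x y = - e (x ⊣ y) /\ f.2 x y = - e (x ⊢ y).
Proof.
split=> [/memv_imgP[e _ ->] | [e fe]].
  by exists e => x y; rewrite linfun_raw ?cobound2E //; apply: cobound2_linear.
apply/memv_imgP; exists e; first exact: memvf.
rewrite linfun_raw; last exact: cobound2_linear.
by apply: cochain2_eq => x y; rewrite !cobound2E.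
Qed.

Lemma B2_sub : (B2 <= Z2)%VS.
Proof.
apply/subvP=> f /memB2[e fe]; apply/memZ2.
have [fl fr] : (forall x y, f.1 x y = - e (x ⊣ y)) /\
               (forall x y, f.2 x y = - e (x ⊢ y)) by split=> x y; case: (fe x y).
split=> i j k; rewrite !(fl, fr).
- by rewrite dleft_lr.
- by rewrite dright_left.
- by rewrite dright_lr.
- by rewrite dleftA.
- by rewrite drightA.
Qed.

Lemma dim_H2 : \dim {: H2} = (\dim Z2 - \dim B2)%N.
Proof.
rewrite dim_vquot !dimvf; congr (_ - _)%N.
set g := linfun _.
have gE : g =1 vsval by move=> z; rewrite lfunE.
have ker0 : lker g = 0%VS.
  apply/eqP/lker0P => z1 z2; rewrite !gE; exact: val_inj.
rewrite -(limg_dim_eq (f := g)) ?ker0 ?capv0 // lpreimK //.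
apply/subvP=> f /(subvP B2_sub) Zf; rewrite -(vsprojK Zf) -gE.
by rewrite memv_img ?memvf.
Qed.

End DiassTheory.

(* Main.v *)
Require Import Defs.
From mathcomp Require Import all_boot all_order all_algebra.
From mathcomp Require Import zify.
Import GRing.Theory Num.Theory.
Local Open Scope ring_scope.

(** Let V be a complement of L' in L, so that \dim V = d.

    A nilpotent algebra is generated by V, and more precisely a left (or right)
    ideal K with K + L' = L is all of L: if L = K + L^m then L' is contained in
    K + L ◊ L^m, hence L = K + L^(m+1) (see [left_ideal_full]).

    For a cocycle f, the identities f⊣(i, j ⊣ k) = f⊣(i, j ⊢ k) = f⊣(i ⊣ j, k)
    say that the right radical {y | f⊣(_, y) = 0} is a left ideal; likewise the
    left radical {x | f⊢(x, _) = 0} is a right ideal. So f is determined by f⊣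
    on L x V and by f⊢ on V x L, and \dim Z2 <= 2nd ([dim_Z2_le]).

    The kernel of the coboundary map consists of the linear forms that vanish on
    L', which are determined by their values on V; so \dim B2 >= n - d
    ([dim_B2_ge]). Hence \dim H2 <= 2nd - n + d, and since d <= n this is at most
    -2d^2 + d + 4nd - n. *)

Section LinearAlgebra.
Set Implicit Arguments.
Unset Strict Implicit.
Variables (F : fieldType) (aT rT : vectType F).

(** A linear map that is injective on U bounds the dimension of U. *)
Lemma dim_inj_le (U : {vspace aT}) (g : aT -> rT) :
    linear g -> (forall u, u \in U -> g u = 0 -> u = 0) ->
  (\dim U <= \dim {: rT})%N.
Proof.
move=> g_lin g_inj; rewrite -(limg_dim_eq (f := linfun g)) ?dimvS ?subvf //.
apply/eqP; rewrite -subv0; apply/subvP=> u /memv_capP[Uu].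
by rewrite memv_ker linfun_raw // memv0 => /eqP/(g_inj u Uu)/eqP.
Qed.

Lemma sub_lker_vbasis (U : {vspace aT}) (g : 'Hom(aT, rT)) :
  (forall j : 'I_(\dim U), g (vbasis U)`_j = 0) -> (U <= lker g)%VS.
Proof.
move=> g0; apply/subvP=> u /coord_vbasis->; apply: rpred_sum => j _.
by rewrite memvZ // memv_ker g0.
Qed.

End LinearAlgebra.

Section Diassociative.
Set Implicit Arguments.
Unset Strict Implicit.
Variables (F : fieldType) (L : fdDiassType F).
Implicit Types (U V W K : {vspace L}) (f : cochain2 L).

Lemma dprod_subP U V W :
  reflect {in U & V, forall u v, u ⊣ v \in W /\ u ⊢ v \in W}
          (dprod U V <= W)%VS.
Proof.
apply: (iffP idP) => [|sW].
  by rewrite subv_add => /andP[/span_prodP sl /span_prodP sr] u v Uu Vv;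
    split; [apply: sl | apply: sr].
by rewrite subv_add; apply/andP; split; apply/span_prodP=> u v Uu Vv;
  case: (sW u v Uu Vv).
Qed.

Lemma lcs_dprodl m : (0 < m)%N -> (dprod fullv (lcs L m) <= lcs L m.+1)%VS.
Proof.
by move=> m_gt0; rewrite lcsS // big_ltn ?ltnS // subSS subn0 lcs1 addvSl.
Qed.

Lemma lcs_dprodr m : (0 < m)%N -> (dprod (lcs L m) fullv <= lcs L m.+1)%VS.
Proof.
by move=> m_gt0; rewrite lcsS // big_nat_recr //= subSnn lcs1 addvSr.
Qed.

(** If L = K + L' and each decomposition L = K + L^m can be pushed one step
    further inside L', then K = L. *)
Lemma nilpotent_full K : nilpotent_diass L -> (K + derived L)%VS = fullv ->
    (forall m, (0 < m)%N -> (K + lcs L m)%VS = fullv ->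
       (derived L <= K + lcs L m.+1)%VS) ->
  K = fullv.
Proof.
move=> [k k_gt0 lcs0] KL' step.
have K_lcs m : (0 < m)%N -> (K + lcs L m)%VS = fullv.
  elim: m => // [[|m] IHm] _; first by rewrite lcs1; apply: addv_idPr (subvf K).
  apply/eqP; rewrite eqEsubv subvf -KL' subv_add addvSl step //.
  exact: IHm.
by rewrite -(K_lcs k k_gt0) lcs0 addv0.
Qed.

Lemma left_ideal_full K : nilpotent_diass L -> (K + derived L)%VS = fullv ->
  (dprod fullv K <= K)%VS -> K = fullv.
Proof.
move=> L_nilp KL' /dprod_subP idK; apply: nilpotent_full => // m m_gt0 Km.
have /dprod_subP prodb := lcs_dprodl m_gt0.
apply/dprod_subP=> x y xL; rewrite -{1}Km => /memv_addP[a Ka [b mb ->]].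
have [aL aR] := idK x a xL Ka; have [bL bR] := prodb x b xL mb.
by rewrite !linearDr; split; apply: memv_add.
Qed.

Lemma right_ideal_full K : nilpotent_diass L -> (K + derived L)%VS = fullv ->
  (dprod K fullv <= K)%VS -> K = fullv.
Proof.
move=> L_nilp KL' /dprod_subP idK; apply: nilpotent_full => // m m_gt0 Km.
have /dprod_subP prodb := lcs_dprodr m_gt0.
apply/dprod_subP=> x y + yL; rewrite -{1}Km => /memv_addP[a Ka [b mb ->]].
have [aL aR] := idK a y Ka yL; have [bL bR] := prodb b y mb yL.
by rewrite !linearDl; split; apply: memv_add.
Qed.

Local Notation n := (\dim {: L}).
Local Notation V := (derived L)^C%VS.
Local Notation d := (\dim V).

Lemma compl_derived_full K : (V <= K)%VS -> (K + derived L)%VS = fullv.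
Proof.
move=> VK; apply/eqP; rewrite eqEsubv subvf -(addv_complf (derived L)).
by rewrite addvC addvS.
Qed.

(** The restrictions of f⊣ to L x V and of f⊢ to V x L, as matrices in the
    chosen bases of L and V. *)
Definition generator_values f : 'M[F]_(n, d) * 'M[F]_(d, n) :=
  (\matrix_(i, j) f.1 (vbasis {: L})`_i (vbasis V)`_j,
   \matrix_(i, j) f.2 (vbasis V)`_i (vbasis {: L})`_j).

Lemma generator_values_linear : linear generator_values.
Proof.
move=> a f g; congr (_, _); apply/matrixP=> i j; rewrite !mxE /=;
by rewrite !(add_lfunE, scale_lfunE).
Qed.

(** The form b with its arguments exchanged, so that [lker (flip b)] is the right
    radical of b, as [lker b] is the left one. *)
Definition flip (b : biform L) : biform L := form_of (fun y x => b x y).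

Lemma flipE (b : biform L) x y : flip b y x = b x y.
Proof.
rewrite /flip form_ofE //; split=> z a u v /=; first by rewrite linearP.
by rewrite linearP add_lfunE scale_lfunE.
Qed.

Lemma hom_full0 (rT : vectType F) (g : 'Hom(L, rT)) : lker g = fullv -> g = 0.
Proof.
by move=> g0; apply/lfunP=> x; apply/eqP; rewrite lfunE -memv_ker g0 memvf.
Qed.

(** The right radical of f⊣ is a left ideal and the left radical of f⊢ is a
    right ideal; both contain V, hence both are L. *)
Lemma cocycle2_eq0 f : nilpotent_diass L -> cocycle2 f ->
  generator_values f = 0 -> f = 0.
Proof.
move=> L_nilp [f1lr _ f2lr f1A f2A] [/matrixP f1V /matrixP f2V].
have f1_0 : flip f.1 = 0.
  apply/hom_full0/left_ideal_full => //.
    apply/compl_derived_full/sub_lker_vbasis => j; apply/hom_full0/eqP.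
    rewrite eqEsubv subvf /=; apply: sub_lker_vbasis => i.
    by have := f1V i j; rewrite flipE !mxE.
  apply/dprod_subP=> j k _; rewrite !memv_ker => /eqP fk0.
  have fk i : f.1 i k = 0 by rewrite -flipE fk0 lfunE.
  by split; apply/eqP/lfunP=> i; rewrite flipE lfunE -?f1lr f1A fk.
have f2_0 : f.2 = 0.
  apply/hom_full0/right_ideal_full => //.
    apply/compl_derived_full/sub_lker_vbasis => i; apply/hom_full0/eqP.
    rewrite eqEsubv subvf /=; apply: sub_lker_vbasis => j.
    by have := f2V i j; rewrite !mxE.
  apply/dprod_subP=> i j; rewrite !memv_ker => /eqP fi0 _.
  by split; apply/eqP/lfunP=> k; rewrite ?f2lr -f2A fi0 !lfunE.
apply: cochain2_eq => x y; rewrite f2_0; split=> //.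
by rewrite -flipE f1_0 !lfunE.
Qed.

Lemma dim_Z2_le : nilpotent_diass L -> (\dim (Z2 L) <= 2 * n * d)%N.
Proof.
move=> L_nilp; apply: leq_trans (dim_inj_le generator_values_linear _) _.
  by move=> f /memZ2 Zf; apply: cocycle2_eq0.
have -> : \dim {: ('M[F]_(n, d) * 'M[F]_(d, n))%type} =
  (n * d + d * n)%N by rewrite dimvf.
lia.
Qed.

(** The linear forms that vanish on L' are determined by their values on V. *)
Lemma dim_B2_ge : (n <= \dim (B2 L) + d)%N.
Proof.
pose g (e : 'Hom(L, F^o)) : 'rV[F]_d := \row_j e (vbasis V)`_j.
have g_lin : linear g.
  by move=> a e e'; apply/rowP=> j; rewrite !mxE add_lfunE scale_lfunE.
have ker_le : (\dim (lker (linfun (@cobound2 F L))) <= d)%N.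
  have -> : d = \dim {: 'rV[F]_d} by rewrite dimvf /dim /= mul1n.
  apply: dim_inj_le g_lin _ => e.
  rewrite memv_ker linfun_raw; last exact: cobound2_linear.
  move=> /eqP e0 /rowP ge0; apply: hom_full0.
  apply/eqP; rewrite eqEsubv subvf -(addv_complf (derived L)) subv_add /=.
  apply/andP; split.
    apply/dprod_subP=> x y _ _.
    have zero_form : (0 : biform L) x y = 0 by rewrite !zero_lfunE.
    have [el er] := cobound2E e x y; rewrite e0 /= zero_form in el er.
    by split; rewrite memv_ker -oppr_eq0 -?el -?er.
  by apply: sub_lker_vbasis => j; have := ge0 j; rewrite !mxE.
have <- : \dim {: 'Hom(L, F^o)} = n by rewrite !dimvf /dim /= muln1.
rewrite -(limg_ker_dim (linfun (@cobound2 F L)) fullv) capfv -/(B2 L).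
by rewrite addnC leq_add2l.
Qed.

End Diassociative.

Theorem corollary4p7 (F : fieldType) (L : fdDiassType F) (n d : nat)
    (L_nilp : nilpotent_diass L)
    (n_def : n = \dim {: L})
    (d_def : d = \dim {: vquot (derived L)}) :
  (\dim {: H2 L})%:Z <= - 2 * d%:Z ^+ 2 + d%:Z + 4 * n%:Z * d%:Z - n%:Z.
Proof.
have d_compl : \dim (derived L)^C = d by rewrite d_def dim_vquot dimv_compl dimvf.
have le_dn : (d <= n)%N by rewrite -d_compl n_def dimvS ?subvf.
have Z_le := dim_Z2_le L_nilp; have B_ge := dim_B2_ge L.
have BZ : (\dim (B2 L) <= \dim (Z2 L))%N by rewrite dimvS ?B2_sub.
rewrite d_compl -n_def in Z_le B_ge; rewrite dim_H2; nia.
Qed.
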